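(* Let $X$ be a Tychonoff space and let $\mathrm{C}(X)$ be the vector lattice of all real-valued continuous functions on $X$. Then the following statements are equivalent. (i) $\mathrm{C}(X)$ is laterally $\sigma$-complete. (ii) $\mathrm{C}(X)$ is universally $\sigma$-complete. (iii) $X$ is a P-space.
   Context: A Tychonoff space is a completely regular $\mathrm{T}_1$ topological space. $\mathrm{C}(X)$ carries the pointwise vector space operations and the pointwise order. Two elements $u,v$ of a vector lattice $L$ are disjoint if $|u|\wedge|v|=0$. A vector lattice $L$ is laterally $\sigma$-complete if every nonempty countable set of mutually disjoint elements of its positive cone $L^+$ has a supremum in $L$. It is Dedekind $\sigma$-complete if every nonempty countable subset that is bounded above has a supremum in $L$. It is universally $\sigma$-complete if it is both Dedekind $\sigma$-complete and laterally $\sigma$-complete. $X$ is a P-space if the intersection of countably many open sets in $X$ is open. *)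

(* Defs.v *)
From HB Require Import structures.
From mathcomp Require Import all_boot all_order all_algebra.
From mathcomp Require Import all_classical all_reals all_analysis.
Import Order.TTheory GRing.Theory Num.Theory.
Import numFieldNormedType.Exports.

Set Implicit Arguments.
Unset Strict Implicit.
Unset Printing Implicit Defensive.

Local Open Scope classical_set_scope.
Local Open Scope ring_scope.

(* Joining [Order.Lattice] with additive structures clashes with the existing
   join [Num.RealDomain], hence the explicit lattice operations. *)
HB.mixin Record POrderedLmodule_isVectorLattice (R : realType) V
    of GRing.Lmodule R V & Order.POrder ring_display V := {
  vmeet : V -> V -> V ;
  vjoin : V -> V -> V ;
  le_vmeet : forall w u v : V, (w <= vmeet u v) = (w <= u) && (w <= v) ;
  vjoin_le : forall u v w : V, (vjoin u v <= w) = (u <= w) && (v <= w) ;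
  vlat_leD2r : forall w u v : V, u <= v -> u + w <= v + w ;
  vlat_leZ : forall (a : R) (u v : V), 0 <= a -> u <= v -> a *: u <= a *: v
}.

#[short(type="vectorLatticeType")]
HB.structure Definition VectorLattice (R : realType) :=
  { V of GRing.Lmodule R V & Order.POrder ring_display V
       & POrderedLmodule_isVectorLattice R V }.

Section vector_lattice_notions.
Context {R : realType} {L : vectorLatticeType R}.
Implicit Types (u v : L) (A : set L).

Definition vabs u : L := vjoin u (- u).

Definition disjoint_elements u v := vmeet (vabs u) (vabs v) = 0.

Definition mutually_disjoint A :=
  forall u v, A u -> A v -> u <> v -> disjoint_elements u v.

End vector_lattice_notions.

Section completeness.
Context {R : realType} (L : vectorLatticeType R).

(* In mathcomp-analysis, [countable] includes finite sets. *)
Definition laterally_sigma_complete :=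
  forall A : set L, A !=set0 -> countable A -> A `<=` [set u | 0 <= u] ->
    mutually_disjoint A -> exists s, isLub A s.

Definition dedekind_sigma_complete :=
  forall A : set L, A !=set0 -> countable A -> has_ubound A ->
    exists s, isLub A s.

Definition universally_sigma_complete :=
  dedekind_sigma_complete /\ laterally_sigma_complete.

End completeness.

(* The library phrases [completely_regular_space] through uniformities; see
   [completely_regular_spaceP] for the separation by real functions. *)
Definition tychonoff_space (X : topologicalType) :=
  completely_regular_space X /\ accessible_space X.

Lemma completely_regular_spaceP (R : realType) (X : topologicalType) :
  completely_regular_space X <->
  forall (a : X) (B : set X), closed B -> ~ B a ->
    exists f : X -> R, [/\ continuous f, range f `<=` `[0, 1]%classic,
      f a = 0 & forall b, B b -> f b = 1].
Proof.
split=> crX a B clB nBa.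
  have /(uniform_separatorP (R := R))[f [cf f01 f0 f1]] := crX a B clB nBa.
  exists f; split=> //; first by apply: f0; exists a.
  by move=> b Bb; apply: f1; exists b.
have [f [cf f01 f0 f1]] := crX a B clB nBa.
apply/(uniform_separatorP (R := R)); exists f; split=> //.
  by move=> _ [_ -> <-].
by move=> _ [b Bb <-]; exact: f1.
Qed.

Definition P_space (X : topologicalType) :=
  forall U : nat -> set X, (forall n, open (U n)) -> open (\bigcap_n U n).

(* An alias of [continuousType X R], so that the pointwise structures below
   are not attached to the library type itself. *)
Definition Cfun (X : topologicalType) (R : realType) : Type :=
  continuousType X R.

Section Cfun.
Context {X : topologicalType} {R : realType}.
Implicit Types (f g h : Cfun X R) (a : R) (x : X).

HB.instance Definition _ := Choice.copy (Cfun X R) (continuousType X R).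

Definition Cfun_fun f : X -> R := (f : continuousType X R).
Coercion Cfun_fun : Cfun >-> Funclass.

Definition Cfun_mk (f : X -> R) (cf : continuous f) : Cfun X R :=
  mkcts cf : continuousType X R.

Lemma Cfun_continuous f : continuous f.
Proof. exact: cts_fun. Qed.

Lemma CfunP f g : (forall x, f x = g x) -> f = g.
Proof. by move=> fg; apply/continuousEP. Qed.

Fact Cfun_cst_subproof a : continuous (fun _ : X => a).
Proof. by move=> x; exact: cvg_cst. Qed.

Fact Cfun_opp_subproof f : continuous (fun x => - f x).
Proof. by move=> x; apply: continuousN; exact: Cfun_continuous. Qed.

Fact Cfun_add_subproof f g : continuous (fun x => f x + g x).
Proof. by move=> x; apply: continuousD; exact: Cfun_continuous. Qed.

Fact Cfun_scale_subproof a f : continuous (fun x => a * f x).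
Proof.
by move=> x; apply: continuousM; [exact: cvg_cst|exact: Cfun_continuous].
Qed.

Fact Cfun_min_subproof f g : continuous (fun x => Num.min (f x) (g x)).
Proof. by move=> x; apply: continuous_min; exact: Cfun_continuous. Qed.

Fact Cfun_max_subproof f g : continuous (fun x => Num.max (f x) (g x)).
Proof. by move=> x; apply: continuous_max; exact: Cfun_continuous. Qed.

Let zero := Cfun_mk (@Cfun_cst_subproof 0).
Let opp f := Cfun_mk (@Cfun_opp_subproof f).
Let add f g := Cfun_mk (@Cfun_add_subproof f g).
Let scale a f := Cfun_mk (@Cfun_scale_subproof a f).
Let le f g := `[< forall x, f x <= g x >].
Let meet f g := Cfun_mk (@Cfun_min_subproof f g).
Let join f g := Cfun_mk (@Cfun_max_subproof f g).

Fact Cfun_addA : associative add.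
Proof. by move=> f g h; apply: CfunP => x; exact: addrA. Qed.

Fact Cfun_addC : commutative add.
Proof. by move=> f g; apply: CfunP => x; exact: addrC. Qed.

Fact Cfun_add0 : left_id zero add.
Proof. by move=> f; apply: CfunP => x; exact: add0r. Qed.

Fact Cfun_addN : left_inverse zero opp add.
Proof. by move=> f; apply: CfunP => x; exact: addNr. Qed.

HB.instance Definition _ :=
  GRing.isZmodule.Build (Cfun X R) Cfun_addA Cfun_addC Cfun_add0 Cfun_addN.

Fact Cfun_scaleA a b f : scale a (scale b f) = scale (a * b) f.
Proof. by apply: CfunP => x; exact: mulrA. Qed.

Fact Cfun_scale1 : left_id 1 scale.
Proof. by move=> f; apply: CfunP => x; exact: mul1r. Qed.

Fact Cfun_scaleDr : right_distributive scale +%R.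
Proof. by move=> a f g; apply: CfunP => x; exact: mulrDr. Qed.

Fact Cfun_scaleDl f : {morph scale^~ f : a b / a + b}.
Proof. by move=> a b; apply: CfunP => x; exact: mulrDl. Qed.

HB.instance Definition _ := GRing.Zmodule_isLmodule.Build R (Cfun X R)
  Cfun_scaleA Cfun_scale1 Cfun_scaleDr Cfun_scaleDl.

Fact Cfun_le_refl : reflexive le.
Proof. by move=> f; apply/asboolP. Qed.

Fact Cfun_le_anti : antisymmetric le.
Proof.
move=> f g /andP[/asboolP fg /asboolP gf]; apply: CfunP => x.
by apply/le_anti; rewrite fg gf.
Qed.

Fact Cfun_le_trans : transitive le.
Proof.
move=> g f h /asboolP fg /asboolP gh; apply/asboolP => x.
exact: le_trans (fg x) (gh x).
Qed.

HB.instance Definition _ := Order.Le_isPOrder.Build ring_display (Cfun X R)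
  Cfun_le_refl Cfun_le_anti Cfun_le_trans.

Lemma Cfun_leP f g : reflect (forall x, f x <= g x) (f <= g).
Proof. exact: asboolP. Qed.

Fact Cfun_lexI h f g : (h <= meet f g) = (h <= f) && (h <= g).
Proof.
apply/Cfun_leP/andP => [hfg|[/Cfun_leP hf /Cfun_leP hg] x]; last first.
  by rewrite /= le_min hf hg.
by split; apply/Cfun_leP => x; have := hfg x; rewrite le_min => /andP[].
Qed.

Fact Cfun_leUx f g h : (join f g <= h) = (f <= h) && (g <= h).
Proof.
apply/Cfun_leP/andP => [fgh|[/Cfun_leP fh /Cfun_leP gh] x]; last first.
  by rewrite /= ge_max fh gh.
by split; apply/Cfun_leP => x; have := fgh x; rewrite ge_max => /andP[].
Qed.

Fact Cfun_leD2r h f g : f <= g -> f + h <= g + h.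
Proof.
by move=> /Cfun_leP fg; apply/Cfun_leP => x; exact: lerD (fg x) (lexx _).
Qed.

Fact Cfun_leZ a f g : 0 <= a -> f <= g -> a *: f <= a *: g.
Proof.
by move=> a0 /Cfun_leP fg; apply/Cfun_leP => x; exact: ler_wpM2l (fg x).
Qed.

HB.instance Definition _ := POrderedLmodule_isVectorLattice.Build R (Cfun X R)
  Cfun_lexI Cfun_leUx Cfun_leD2r Cfun_leZ.

Lemma Cfun0E x : (0 : Cfun X R) x = 0. Proof. by []. Qed.
Lemma CfunNE f x : (- f) x = - f x. Proof. by []. Qed.
Lemma CfunDE f g x : (f + g) x = f x + g x. Proof. by []. Qed.
Lemma CfunZE a f x : (a *: f) x = a * f x. Proof. by []. Qed.
Lemma Cfun_vmeetE f g x : (vmeet f g) x = Num.min (f x) (g x).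
Proof. by []. Qed.
Lemma Cfun_vjoinE f g x : (vjoin f g) x = Num.max (f x) (g x).
Proof. by []. Qed.

End Cfun.

(* Main.v *)
Require Import Defs.
From mathcomp Require Import all_boot all_order all_algebra.
From mathcomp Require Import all_classical all_reals all_analysis.
From mathcomp Require Import lra zify.
Import Order.TTheory GRing.Theory Num.Theory.
Import numFieldNormedType.Exports.

(** In a P-space every neighbourhood filter is closed under countable
intersections, so countably many continuous real functions are simultaneously
constant near each point, and so is their pointwise supremum whenever it is
finite: it is continuous, hence a supremum in C(X) ([P_space_isLub]).
Pointwise finiteness is clear for a set bounded above in C(X); for a disjoint
set in the positive cone it holds because at most one member is nonzero at any
given point.  Thus C(X) is universally sigma-complete.

Conversely, let C(X) be laterally sigma-complete.  The heart of the matter is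
[lateral_zero_near]: a continuous f >= 0 vanishing at a vanishes near a.  The
bumps [bump n t], supported where 1/t is within distance 1 of n and of height
about n, are pairwise disjoint for n of a fixed parity, and those of both
parities together exceed any given bound at every sufficiently small t > 0.
So the suprema in C(X) of the two disjoint families of functions
x |-> bump n (f x), being continuous at a, are bounded near a, which leaves no
point near a with f > 0.
Finally, a point a of a countable intersection of open sets U n is a zero of
a function h = sup_n f_n / (n + 1), where f_n separates a from the complement
of U n by complete regularity; since h vanishes near a, each f_n does, and the
intersection contains a neighbourhood of a ([lateral_P_space]). *)

Set Implicit Arguments.
Unset Strict Implicit.
Unset Printing Implicit Defensive.

Local Open Scope classical_set_scope.
Local Open Scope ring_scope.

(** * Pointwise suprema and pointwise disjointness *)

Section sup_of_sequence.
Context {R : realType} {X : topologicalType}.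
Implicit Types (F : nat -> X -> R) (x y : X).

Definition seq_sup F x : R := sup (range (F^~ x)).

Definition pointwise_bounded F := forall x, has_ubound (range (F^~ x)).

Lemma seq_sup_ge F n x : pointwise_bounded F -> F n x <= seq_sup F x.
Proof. by move=> bF; apply: ub_le_sup => //; exists n. Qed.

Lemma seq_sup_le F x c : (forall n, F n x <= c) -> seq_sup F x <= c.
Proof.
move=> Fc; apply: ge_sup; first by exists (F 0 x); exists 0.
by move=> _ [n _ <-].
Qed.

(** Equicontinuity at x passes to the supremum: a uniform error e in all terms
gives an error at most e in the supremum.  This serves both for sequences that
are locally constant near x and for uniformly small tails. *)
Lemma seq_sup_continuous_at F x : pointwise_bounded F ->
  (forall e, 0 < e -> \forall y \near x, forall n, `|F n x - F n y| <= e) ->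
  {for x, continuous (seq_sup F)}.
Proof.
move=> bF eqF; apply/cvgrPdist_le => e /eqF; apply: filterS => y Fxy.
have sup_close u v : (forall n, F n u <= F n v + e) ->
    seq_sup F u <= seq_sup F v + e.
  move=> Fuv; apply: seq_sup_le => n; apply: le_trans (Fuv n) _.
  by rewrite lerD2r seq_sup_ge.
rewrite ler_distl; apply/andP; split.
  by rewrite lerBlDr sup_close // => n; have := Fxy n; rewrite ler_distl; lra.
by apply: sup_close => n; have := Fxy n; rewrite ler_distl; lra.
Qed.

End sup_of_sequence.

Lemma Cfun_disjointP (R : realType) (X : topologicalType) (f g : Cfun X R) :
  disjoint_elements f g <-> forall x, Num.min `|f x| `|g x| = 0.
Proof.
have minE x : (vmeet (vabs f) (vabs g) : Cfun X R) x = Num.min `|f x| `|g x|.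
  exact: congr2 (maxrN (f x)) (maxrN (g x)).
split=> [fg x|fg]; last by apply: CfunP => x; rewrite minE.
by rewrite -minE [vmeet _ _]fg.
Qed.

(** * P-spaces: pointwise suprema are continuous *)

Section P_space_complete.
Context {R : realType} {X : topologicalType}.

Lemma P_space_near_forall (P : nat -> set X) (x : X) : P_space X ->
  (forall n, \forall y \near x, P n y) -> \forall y \near x, forall n, P n y.
Proof.
move=> PX nP; have : nbhs x (\bigcap_n (P n)°).
  apply: open_nbhs_nbhs; split; last by move=> n _; exact: nP.
  by apply: PX => n; exact: open_interior.
by apply: filterS => y Py n; apply: interior_subset; exact: Py.
Qed.

(** The level set of f through x is the countable intersection of the
neighbourhoods of x on which f stays within 1 / (n + 1) of f x. *)
Lemma P_space_locally_constant (f : X -> R) (x : X) : P_space X ->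
  continuous f -> \forall y \near x, f y = f x.
Proof.
move=> PX cf.
have : \forall y \near x, forall n, `|f x - f y| <= n.+1%:R^-1.
  apply: P_space_near_forall => // n.
  by apply: (cvgr_dist_le _ _ (cf x)).
apply: filterS => y fxy; apply/eqP; rewrite eq_le; apply/andP; split;
  rewrite leNgt; apply/negP => /ltr_add_invr[k];
  by have := fxy k; rewrite ler_distl; move: (_^-1) => c /andP[? ?] ?; lra.
Qed.

(** Near each point all the members of A are constant at once, hence so is their
pointwise supremum; a pointwise supremum that is continuous is the supremum in
C(X). *)
Lemma P_space_isLub (A : set (Cfun X R)) : P_space X ->
  A !=set0 -> countable A ->
  (forall x, exists c, forall f, A f -> f x <= c) ->
  exists s, isLub A s.
Proof.
move=> PX A0 cA bA.
have [A_eq0|[e]] := pfcard_geP cA.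
  by move: A0; rewrite A_eq0 => -[].
have rangeA n : A (e n) by exact: (@funS _ _ _ _ e).
have bF : pointwise_bounded (fun n => e n : X -> R).
  by move=> x; have [c Ac] := bA x; exists c => _ [n _ <-]; exact: Ac.
have cs : continuous (seq_sup (fun n => e n : X -> R)).
  move=> x; apply: seq_sup_continuous_at => // eps eps0.
  have : \forall y \near x, forall n, e n y = e n x.
    apply: P_space_near_forall => // n.
    by apply: P_space_locally_constant => //; exact: Cfun_continuous.
  by apply: filterS => y eyx n; rewrite eyx subrr normr0 ltW.
exists (Cfun_mk cs); split => [f Af|g gub].
  have [n _ <-] := @surj _ _ _ _ e f Af.
  by apply/Cfun_leP => x; exact: (seq_sup_ge n x bF).
apply/Cfun_leP => x; apply: seq_sup_le => n.
by have /Cfun_leP := gub _ (rangeA n); exact.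
Qed.

(** Disjoint functions never are nonzero at the same point, so the value at x of
a member positive at x, if there is one, bounds all the others there. *)
Lemma disjoint_pointwise_bounded (A : set (Cfun X R)) :
  A `<=` [set u | 0 <= u] -> mutually_disjoint A ->
  forall x, exists c, forall f, A f -> f x <= c.
Proof.
move=> A0 dA x.
have [[f Af fx]|/forall2NP nA] := pselect (exists2 f, A f & 0 < f x);
  last first.
  by exists 0 => f Af; have [//|/negP] := nA f; rewrite -leNgt.
exists (f x) => g Ag; have [->//|/eqP gf] := eqVneq g f.
have /Cfun_disjointP/(_ x) := dA _ _ Ag Af gf; rewrite (gtr0_norm fx).
have gx : 0 <= g x by have /Cfun_leP := A0 g Ag; exact.
by rewrite (ger0_norm gx) /Order.min; case: ifP => _; lra.
Qed.

Lemma P_space_universally_sigma_complete :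
  P_space X -> universally_sigma_complete (Cfun X R).
Proof.
move=> PX; split=> A A0 cA.
  move=> [g gub]; apply: P_space_isLub => // x; exists (g x) => f /gub.
  by move/Cfun_leP.
move=> Apos dA; apply: P_space_isLub => //.
exact: disjoint_pointwise_bounded.
Qed.

End P_space_complete.

(** * Bumps of growing height accumulating at 0 *)

Section bumps.
Context {R : realType}.
Implicit Types (t M : R) (m n : nat).

(** For t > 0 this is n^2 t times the positive part of 1 - |1/t - n|; clearing
the denominator makes the continuity at t = 0 evident. *)
Definition bump n t : R := n%:R ^+ 2 * Num.max 0 (t - `|1 - n%:R * t|).

Lemma bump_ge0 n t : 0 <= bump n t.
Proof. by rewrite mulr_ge0 ?exprn_ge0 ?le_max ?lexx. Qed.

Lemma bump_neq0 n t : bump n t != 0 -> `|1 - n%:R * t| < t.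
Proof.
apply: contraNT; rewrite -leNgt => nt.
by rewrite /bump max_l ?mulr0// subr_le0.
Qed.

(** The supports in the variable 1/t are the intervals ]n - 1, n + 1[, which are
disjoint as soon as the centres are at distance at least 2. *)
Lemma bump_disjoint m n t : (m.+2 <= n)%N -> Num.min (bump m t) (bump n t) = 0.
Proof.
move=> mn.
have [->|/bump_neq0 mt] := eqVneq (bump m t) 0.
  by rewrite min_l ?bump_ge0.
have [->|/bump_neq0 nt] := eqVneq (bump n t) 0.
  by rewrite min_r ?bump_ge0.
have t0 : 0 < t by exact: le_lt_trans mt.
have : (m.+2%:R : R) * t <= n%:R * t by rewrite ler_pM2r// ler_nat.
rewrite -addn2 natrD; move: mt nt; rewrite !ltr_distl; nra.
Qed.

(** If n is the integer nearest to 1/t, the bump is at least n^2 t / 2 at t, hence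
of the order of 1/t. *)
Lemma bump_unbounded M t : 0 <= M -> 0 < t -> t * (4 * M + 2) < 1 ->
  exists n, M < bump n t.
Proof.
move=> M0 t0 tM; have tV : t^-1 * t = 1 by rewrite mulVf ?gt_eqF.
have tV0 : 0 < t^-1 by rewrite invr_gt0.
(* n is the integer nearest to 1/t, at distance at most 1/2 from it. *)
have /truncn_itv/andP[] : 0 <= t^-1 + 2^-1 by lra.
set n := Num.truncn _ => nle ltn; exists n.
rewrite -(natr1 n) in ltn; set N : R := n%:R in nle ltn *.
have Nt_le : N * t <= 1 + t / 2.
  by have := ler_wpM2r (ltW t0) nle; rewrite mulrDl tV; lra.
have Nt_ge : 1 - t / 2 <= N * t.
  by have := ltW ltn; rewrite -(ler_pM2r t0) !mulrDl tV; lra.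
have dist : `|1 - N * t| <= t / 2 by rewrite ler_distl; apply/andP; split; lra.
have N1 : 4 * M + 1 < N.
  have : 4 * M + 2 < t^-1 by rewrite -(ltr_pM2r t0) tV mulrC.
  by lra.
have t12 : t < 2^-1 by nra.
apply: (@lt_le_trans _ _ (N ^+ 2 * (t / 2))).
  have : (4 * M + 1) * (1 / 2) <= N * (N * t) by apply: ler_pM; lra.
  by rewrite expr2; lra.
by rewrite ler_wpM2l ?exprn_ge0// le_max; apply/orP; right; lra.
Qed.

End bumps.

(** * Lateral completeness forces the P-space property *)

Section lateral_P_space.
Context {R : realType} {X : topologicalType}.

(** The function x |-> bump n (f x), written with the vector lattice operations
so that it is continuous by construction. *)
Definition Cfun_bump (f : Cfun X R) n : Cfun X R :=
  (n%:R ^+ 2 : R) *: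
    vjoin 0 (f - vabs (Cfun_mk (@Cfun_cst_subproof X R 1) - (n%:R : R) *: f)).

Lemma Cfun_bumpE f n x : Cfun_bump f n x = bump n (f x).
Proof.
exact: (congr1 (fun v => n%:R ^+ 2 * Num.max 0 (f x - v))
               (maxrN (1 - n%:R * f x))).
Qed.

(** Consecutive bumps overlap; keeping only the indices of the parity of b makes
them disjoint. *)
Lemma lateral_bump_isLub (f : Cfun X R) (b : nat) :
  laterally_sigma_complete (Cfun X R) ->
  exists s, isLub (range (fun k => Cfun_bump f (k.*2 + b))) s.
Proof.
apply; first by exists (Cfun_bump f (0.*2 + b)); exists 0%N.
- by apply: card_le_trans (card_image_le _ _) _; exact: countableP.
- by move=> _ [k _ <-]; apply/Cfun_leP => x; rewrite Cfun_bumpE bump_ge0.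
move=> _ _ [j _ <-] [k _ <-] jk; apply/Cfun_disjointP => x.
rewrite !Cfun_bumpE !ger0_norm ?bump_ge0//.
have [jk'|kj|jk'] := ltngtP j k; last by rewrite jk' in jk.
- by apply: bump_disjoint; lia.
- by rewrite minC; apply: bump_disjoint; lia.
Qed.

(** Near a the suprema of the even and of the odd bumps are both below some M,
whereas wherever f is positive and small some bump exceeds M. *)
Lemma lateral_zero_near (f : Cfun X R) (a : X) :
  laterally_sigma_complete (Cfun X R) ->
  (forall x, 0 <= f x) -> f a = 0 -> \forall x \near a, f x = 0.
Proof.
move=> lX f0 fa.
have [s [sub _]] := lateral_bump_isLub f 0 lX.
have [t [tub _]] := lateral_bump_isLub f 1 lX.
pose M := `|s a| + `|t a| + 1.
have M0 : 0 < M by rewrite ltr_wpDl.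
have near_lt (g : Cfun X R) c : g a < c -> \forall x \near a, g x < c.
  by move=> gac; exact: (cvgr_lt _ (Cfun_continuous (x := a))).
have sM : s a < M.
  by rewrite /M; have := ler_norm (s a); have := normr_ge0 (t a); lra.
have tM : t a < M.
  by rewrite /M; have := ler_norm (t a); have := normr_ge0 (s a); lra.
have fM : f a < (4 * M + 2)^-1 by rewrite fa invr_gt0; lra.
near=> x; apply/eqP; rewrite eq_le f0 andbT leNgt; apply/negP => fx0.
have [|n] := bump_unbounded (ltW M0) fx0.
  by rewrite -ltr_pdivlMr ?div1r; [near: x; exact: near_lt|lra].
apply/negP; rewrite -leNgt -Cfun_bumpE.
have -> : n = (n./2.*2 + odd n)%N by rewrite addnC odd_double_half.
case: (odd n).
  apply: (@le_trans _ _ (t x)); last by apply: ltW; near: x; exact: near_lt.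
  by apply/Cfun_leP; apply: tub; exists n./2.
apply: (@le_trans _ _ (s x)); last by apply: ltW; near: x; exact: near_lt.
by apply/Cfun_leP; apply: sub; exists n./2.
Unshelve. all: by end_near. Qed.

(** A countable intersection of open sets, seen from a point a in it, contains the
zero set of a single continuous h >= 0 with h a = 0; by the previous lemma that
zero set is a neighbourhood of a. *)
Lemma lateral_P_space : completely_regular_space X ->
  laterally_sigma_complete (Cfun X R) -> P_space X.
Proof.
move=> /(completely_regular_spaceP R) crX lX U oU; rewrite openE => a Ua.
have /choice[f fP] : forall n, exists f : X -> R,
    [/\ continuous f, range f `<=` `[0, 1], f a = 0 &
        forall x, (~` U n) x -> f x = 1].
  by move=> n; apply: crX; [exact: open_closedC|apply; exact: Ua].
have f01 n x : 0 <= f n x <= 1.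
  by have [_ + _ _] := fP n; move/(_ (f n x)); rewrite /= in_itv/=; apply;
    exists x.
(* The weights make the sequence equicontinuous and leave the zero sets
   unchanged. *)
pose F n x := f n x / n.+1%:R.
have bF : pointwise_bounded F.
  move=> x; exists 1 => _ [n _ <-]; rewrite ler_pdivrMr// mul1r.
  by have /andP[_ /le_trans] := f01 n x; apply; rewrite ler1n.
have F_bounds n x : 0 <= F n x <= n.+1%:R^-1.
  have /andP[? ?] := f01 n x; rewrite divr_ge0//=.
  by rewrite ler_pdivrMr// mulVf ?gt_eqF.
have cs : continuous (seq_sup F).
  move=> x; apply: seq_sup_continuous_at => // e e0.
  (* The terms of index at least k take values in [0, e]; the others are
     finitely many and are controlled by their continuity. *)
  have [k ke] := ltr_add_invr e0; rewrite add0r in ke.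
  have : \forall y \near x, forall n : 'I_k, `|F n x - F n y| <= e.
    apply: filter_forall => n.
    have [cf _ _ _] := fP n.
    have cF : {for x, continuous (F n)}.
      by apply: continuousM; [exact: cf|exact: cvg_cst].
    exact: (cvgr_dist_le _ _ cF).
  apply: filterS => y Fk n; have [nk|kn] := ltnP n k.
    exact: (Fk (Ordinal nk)).
  have ne : n.+1%:R^-1 <= e.
    apply: le_trans (ltW ke); rewrite lef_pV2 ?posrE// ler_nat; lia.
  have /andP[? Fx] := F_bounds n x; have /andP[? Fy] := F_bounds n y.
  have {}Fx := le_trans Fx ne; have {}Fy := le_trans Fy ne.
  by rewrite ler_distl; apply/andP; split; lra.
have s0 x : 0 <= seq_sup F x.
  by have /andP[/le_trans + _] := F_bounds 0%N x; apply; exact: seq_sup_ge.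
have sa : seq_sup F a = 0.
  apply/eqP; rewrite eq_le s0 andbT; apply: seq_sup_le => n.
  by have [_ _ fa _] := fP n; rewrite /F fa mul0r.
have := @lateral_zero_near (Cfun_mk cs) a lX s0 sa.
apply: filterS => x /= sx n _.
apply: contrapT => nUx; have [_ _ _ f1] := fP n.
have := seq_sup_ge n x bF; rewrite [seq_sup F x]sx /F f1//.
by rewrite div1r leNgt invr_gt0 ltr0n.
Qed.

End lateral_P_space.

Theorem theorem3p1 (R : realType) (X : topologicalType) :
  tychonoff_space X ->
  [<-> laterally_sigma_complete (Cfun X R);
       universally_sigma_complete (Cfun X R);
       P_space X].
Proof.
move=> [crX _]; tfae.
- by move=> /(lateral_P_space crX); exact: P_space_universally_sigma_complete.
- by move=> [_]; exact: (lateral_P_space crX).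
- by move=> /(P_space_universally_sigma_complete (R := R))[].
Qed.
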